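(* Let $\mathfrak{r}_{3,-1}$ be the real Lie algebra with basis $\{x,y,h\}$ and brackets $[h,x]=x$, $[h,y]=-y$, $[x,y]=0$. The isomorphism classes of Lie bialgebras with underlying Lie algebra $\mathfrak{r}_{3,-1}$ are represented by the following cobrackets (matrices with respect to the bases $\{x,y,h\}$ and $\{x\wedge y,\,y\wedge h,\,h\wedge x\}$): $$\begin{pmatrix}0&0&0\\0&-a_3&0\\ a_3&0&0\end{pmatrix},\ a_3>0;\qquad 0;\qquad \begin{pmatrix}0&0&1\\0&0&0\\0&0&0\end{pmatrix};\qquad \begin{pmatrix}1&0&0\\0&0&-1\\0&0&0\end{pmatrix};$$ $$\begin{pmatrix}1&0&1\\0&0&-1\\0&0&0\end{pmatrix};\qquad \begin{pmatrix}1&1&c_1\\0&0&-1\\0&0&-1\end{pmatrix},\ c_1\in\mathbb{R}.$$ That is, each of these is a Lie bialgebra cobracket on $\mathfrak{r}_{3,-1}$, and every real Lie bialgebra with underlying Lie algebra $\mathfrak{r}_{3,-1}$ is isomorphic to exactly one of them.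
   Context: A Lie bialgebra over a field $\mathbb{K}$ is a triple $(\mathfrak{g},[-,-],\delta)$ where $(\mathfrak{g},[-,-])$ is a Lie algebra over $\mathbb{K}$ and $\delta:\mathfrak{g}\to\Lambda^2\mathfrak{g}$ is a linear map (the cobracket) such that the induced map $\delta^*:\Lambda^2\mathfrak{g}^*\to\mathfrak{g}^*$ is a Lie algebra structure on $\mathfrak{g}^*$ (co-Jacobi condition) and $\delta$ is a 1-cocycle, i.e. $\delta[s,t]=[\delta s,t]+[s,\delta t]$ for all $s,t\in\mathfrak g$, with $\mathfrak{g}$ acting on $\Lambda^2\mathfrak{g}$ by the adjoint action ($[s,p\wedge q]=[s,p]\wedge q+p\wedge[s,q]$ and $[p\wedge q,s]=-[s,p\wedge q]$). An isomorphism of Lie bialgebras is a Lie algebra isomorphism $\phi$ with $\delta'\phi=(\phi\wedge\phi)\delta$. Matrix convention: the columns of the matrix of $\delta$ are the coordinates of $\delta(x),\delta(y),\delta(h)$ (in this order) in the ordered basis $\{x\wedge y,\,y\wedge h,\,h\wedge x\}$ of $\Lambda^2\mathfrak{g}$. *)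

(* Defs.v *)
From HB Require Import structures.
From mathcomp Require Import all_boot all_order all_algebra.
From mathcomp Require Import reals.

Set Implicit Arguments.
Unset Strict Implicit.
Unset Printing Implicit Defensive.

Import Order.TTheory GRing.Theory Num.Theory.

Local Open Scope ring_scope.

Definition dual (K : fieldType) (V : vectType K) : vectType K := 'Hom(V, K^o).

(* V (x) V for V of finite dimension: p (x) q is the map f |-> f(p) q. *)
Definition tensor2 (K : fieldType) (V : vectType K) : vectType K :=
  'Hom(dual V, V).

Section Tensors.
Variable K : fieldType.

Definition tens (V : vectType K) (p q : V) : tensor2 V :=
  linfun (fun f : dual V => (f p : K) *: q).

Lemma tensE (V : vectType K) (p q : V) (f : dual V) :
  tens p q f = (f p : K) *: q.
Proof.
have lin : linear (fun f : dual V => (f p : K) *: q).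
  by move=> a f1 f2; rewrite add_lfunE scale_lfunE scalerDl scalerA.
pose L := GRing.isLinear.Build _ _ _ _ _ lin.
pose F : {linear dual V -> V} := HB.pack (fun f : dual V => (f p : K) *: q) L.
exact: (lfunE F).
Qed.

Definition wedge (V : vectType K) (p q : V) : tensor2 V :=
  tens p q - tens q p.

(* The exterior square, as the subspace of V (x) V spanned by the p /\ q. *)
Definition ext2 (V : vectType K) : {vspace tensor2 V} :=
  <<[seq wedge p q | p <- vbasis fullv, q <- vbasis (fullv : {vspace V})]>>%VS.

Lemma wedge_ext2 (V : vectType K) (p q : V) : wedge p q \in ext2 V.
Proof.
have tDl a (u v w : V) : tens (a *: u + v) w = a *: tens u w + tens v w.
  apply/lfunP => f; rewrite add_lfunE scale_lfunE !tensE linearP scalerDl.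
  by rewrite scalerA.
have tDr a (u v w : V) : tens w (a *: u + v) = a *: tens w u + tens w v.
  apply/lfunP => f; rewrite add_lfunE scale_lfunE !tensE scalerDr !scalerA.
  by rewrite mulrC.
have linl (w : V) : linear (fun u => wedge u w).
  by move=> a u v; rewrite /wedge tDl tDr scalerBr opprD addrACA.
have linr (w : V) : linear (wedge w).
  by move=> a u v; rewrite /wedge tDl tDr scalerBr opprD addrACA.
pose L w : {linear V -> tensor2 V} :=
  HB.pack (fun u => wedge u w) (GRing.isLinear.Build _ _ _ _ _ (linl w)).
pose R w : {linear V -> tensor2 V} :=
  HB.pack (wedge w) (GRing.isLinear.Build _ _ _ _ _ (linr w)).
rewrite (coord_vbasis (memvf p)) (coord_vbasis (memvf q)).
set P := (X in wedge X _).
rewrite -[wedge P _]/(R P _) (linear_sum (R P)); apply: memv_suml => j _.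
rewrite (linearZ_LR (R P)) memvZ //= /P.
rewrite -[wedge _ _]/(L _ _) (linear_sum (L _)); apply: memv_suml => i _.
rewrite (linearZ_LR (L _)) memvZ //=.
by apply/memv_span/allpairs_f; apply: mem_nth; rewrite size_tuple.
Qed.

Definition transpose (V W : vectType K) (u : 'Hom(V, W)) :
    'Hom(dual W, dual V) :=
  linfun (fun f : dual W => (f \o u)%VF : dual V).

(* u (x) w; on the exterior square, tensor_map u u is u /\ u. *)
Definition tensor_map (V W : vectType K) (u w : 'Hom(V, W)) (t : tensor2 V) :
    tensor2 W :=
  (w \o t \o transpose u)%VF.

(* The pairing of f /\ g with the exterior square of V, normalised so that
   (f /\ g)(p /\ q) = f(p) g(q) - f(q) g(p). *)
Definition pairing (V : vectType K) (f g : dual V) (t : tensor2 V) : K^o :=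
  g (t f).

Lemma transposeE (V W : vectType K) (u : 'Hom(V, W)) (f : dual W) :
  transpose u f = (f \o u)%VF.
Proof.
have lin : linear (fun f : dual W => (f \o u)%VF : dual V).
  by move=> a f1 f2; apply/lfunP => v; rewrite !lfunE /= !lfunE /= !lfunE.
pose L := GRing.isLinear.Build _ _ _ _ _ lin.
pose F : {linear dual W -> dual V} :=
  HB.pack (fun f : dual W => (f \o u)%VF : dual V) L.
exact: (lfunE F).
Qed.

Lemma tensor_map_tens (V W : vectType K) (u w : 'Hom(V, W)) (p q : V) :
  tensor_map u w (tens p q) = tens (u p) (w q).
Proof.
apply/lfunP => f.
by rewrite comp_lfunE comp_lfunE transposeE !tensE comp_lfunE linearZ.
Qed.

Lemma tensor_map_wedge (V W : vectType K) (u : 'Hom(V, W)) (p q : V) :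
  tensor_map u u (wedge p q) = wedge (u p) (u q).
Proof.
rewrite /wedge -!tensor_map_tens; apply/lfunP => f.
by rewrite add_lfunE opp_lfunE /tensor_map !comp_lfunE add_lfunE opp_lfunE linearB.
Qed.

Lemma pairing_wedge (V : vectType K) (f g : dual V) (p q : V) :
  pairing f g (wedge p q) = (f p : K) * g q - (f q : K) * g p.
Proof. by rewrite /pairing add_lfunE opp_lfunE !tensE linearB !linearZ. Qed.

End Tensors.

Section LieBialgebras.
Variable K : fieldType.

Definition is_lie_bracket (V : vectType K) (br : V -> V -> V) : Prop :=
  [/\ forall u, linear (br u),
      forall v, linear (br^~ v),
      forall u, br u u = 0 &
      forall u v w, br u (br v w) + br v (br w u) + br w (br u v) = 0].

(* The adjoint action [s, -] on the exterior square (see adj2_wedge). *)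
Definition adj2 (V : vectType K) (br : V -> V -> V) (s : V) (t : tensor2 V) :
    tensor2 V :=
  tensor_map (linfun (br s)) \1%VF t + tensor_map \1%VF (linfun (br s)) t.

Lemma adj2_wedge (V : vectType K) (br : V -> V -> V) (s p q : V) :
  is_lie_bracket br ->
  adj2 br s (wedge p q) = wedge (br s p) q + wedge p (br s q).
Proof.
case=> lin _ _ _.
pose F : {linear V -> V} :=
  HB.pack (br s) (GRing.isLinear.Build _ _ _ _ _ (lin s)).
have adE v : linfun (br s) v = br s v by exact: (lfunE F).
have tmB (u w : 'Hom(V, V)) t1 t2 :
    tensor_map u w (t1 - t2) = tensor_map u w t1 - tensor_map u w t2.
  apply/lfunP => f.
  by rewrite add_lfunE opp_lfunE !comp_lfunE add_lfunE opp_lfunE linearB.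
rewrite /adj2 /wedge !tmB !tensor_map_tens !adE !id_lfunE.
by rewrite [in RHS]addrACA [- _ - _ in RHS]addrC [in RHS]addrACA.
Qed.

(* The map delta^*, seen as a bracket on the dual space. *)
Definition dual_bracket (V : vectType K) (delta : 'Hom(V, tensor2 V))
    (f g : dual V) : dual V :=
  linfun (fun v => pairing f g (delta v)).

Definition is_lie_bialgebra (V : vectType K) (br : V -> V -> V)
    (delta : 'Hom(V, tensor2 V)) : Prop :=
  [/\ is_lie_bracket br,
      forall v, delta v \in ext2 V,
      is_lie_bracket (dual_bracket delta) &
      forall s t, delta (br s t) = - adj2 br t (delta s) + adj2 br s (delta t)].

Definition is_lie_iso (V W : vectType K) (brV : V -> V -> V)
    (brW : W -> W -> W) (phi : 'Hom(V, W)) : Prop :=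
  bijective phi /\ (forall u v, phi (brV u v) = brW (phi u) (phi v)).

Definition lie_isomorphic (V W : vectType K) (brV : V -> V -> V)
    (brW : W -> W -> W) : Prop :=
  exists phi : 'Hom(V, W), is_lie_iso brV brW phi.

Definition bialgebra_isomorphic (V W : vectType K)
    (brV : V -> V -> V) (deltaV : 'Hom(V, tensor2 V))
    (brW : W -> W -> W) (deltaW : 'Hom(W, tensor2 W)) : Prop :=
  exists2 phi : 'Hom(V, W), is_lie_iso brV brW phi &
    forall v, deltaW (phi v) = tensor_map phi phi (deltaV v).

End LieBialgebras.

Section R3.
Variable R : realType.

Definition ex : 'rV[R]_3 := delta_mx 0 (inord 0).
Definition ey : 'rV[R]_3 := delta_mx 0 (inord 1).
Definition eh : 'rV[R]_3 := delta_mx 0 (inord 2).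

Definition r3m1 (u v : 'rV[R]_3) : 'rV[R]_3 :=
  (u 0 (inord 2) * v 0 (inord 0) - u 0 (inord 0) * v 0 (inord 2)) *: ex
  - (u 0 (inord 2) * v 0 (inord 1) - u 0 (inord 1) * v 0 (inord 2)) *: ey.

Let inord3_eq k l : (k < 3)%N -> (l < 3)%N ->
  (inord k == inord l :> 'I_3) = (k == l).
Proof. by move=> hk hl; rewrite -(inj_eq val_inj) /= !inordK. Qed.

Lemma r3m1_hx : r3m1 eh ex = ex.
Proof.
rewrite /r3m1 /eh /ex /ey !mxE !inord3_eq //=.
by rewrite !(mulr0, mul0r, mulr1, subr0, sub0r, oppr0, addr0, scale1r, scale0r).
Qed.

Lemma r3m1_hy : r3m1 eh ey = - ey.
Proof.
rewrite /r3m1 /eh /ex /ey !mxE !inord3_eq //=.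
by rewrite !(mulr0, mul0r, mulr1, subr0, sub0r, oppr0, addr0, scale1r, scale0r).
Qed.

Lemma r3m1_xy : r3m1 ex ey = 0.
Proof.
rewrite /r3m1 /eh /ex /ey !mxE !inord3_eq //=.
by rewrite !(mulr0, mul0r, mulr1, subr0, sub0r, oppr0, addr0, scale1r, scale0r).
Qed.

Definition ext2_basis (i : 'I_3) : tensor2 'rV[R]_3 :=
  nth 0 [:: wedge ex ey; wedge ey eh; wedge eh ex] i.

(* The columns of M are the coordinates of delta(x), delta(y), delta(h). *)
Definition cobracket_of (M : 'M[R]_3) : 'Hom('rV[R]_3, tensor2 'rV[R]_3) :=
  linfun (fun v : 'rV[R]_3 =>
    \sum_(j < 3) v 0 j *: \sum_(i < 3) M i j *: ext2_basis i).

Lemma cobracket_ofE (M : 'M[R]_3) (j : 'I_3) :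
  cobracket_of M (delta_mx 0 j) = \sum_(i < 3) M i j *: ext2_basis i.
Proof.
pose c (v : 'rV[R]_3) :=
  \sum_(k < 3) v 0 k *: \sum_(i < 3) M i k *: ext2_basis i.
have lin : linear c.
  move=> a u v; rewrite /c scaler_sumr -big_split; apply: eq_bigr => k _ /=.
  by rewrite !mxE scalerDl scalerA.
pose F : {linear 'rV[R]_3 -> tensor2 'rV[R]_3} :=
  HB.pack c (GRing.isLinear.Build _ _ _ _ _ lin).
rewrite /cobracket_of -/c (lfunE F) /= /c (bigD1 j) //=.
rewrite [X in _ + X]big1 => [|k kj]; last by rewrite mxE (negPf kj) scale0r.
by rewrite mxE !eqxx scale1r; exact: addr0.
Qed.

Definition mx3 (rows : seq (seq R)) : 'M[R]_3 :=
  \matrix_(i < 3, j < 3) (nth [::] rows i)`_j.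

Inductive normal_form : 'M[R]_3 -> Prop :=
| NF_a3 (a3 : R) of 0 < a3 : normal_form
    (mx3 [:: [:: 0; 0; 0]; [:: 0; - a3; 0]; [:: a3; 0; 0]])
| NF_zero : normal_form 0
| NF_c : normal_form
    (mx3 [:: [:: 0; 0; 1]; [:: 0; 0; 0]; [:: 0; 0; 0]])
| NF_a : normal_form
    (mx3 [:: [:: 1; 0; 0]; [:: 0; 0; -1]; [:: 0; 0; 0]])
| NF_ac : normal_form
    (mx3 [:: [:: 1; 0; 1]; [:: 0; 0; -1]; [:: 0; 0; 0]])
| NF_abc (c1 : R) : normal_form
    (mx3 [:: [:: 1; 1; c1]; [:: 0; 0; -1]; [:: 0; 0; -1]]).

End R3.

(* Main.v *)
Require Import Defs.
From HB Require Import structures.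
From mathcomp Require Import all_boot all_order all_algebra.
From mathcomp Require Import reals.
From mathcomp Require Import ring lra.

Set Implicit Arguments.
Unset Strict Implicit.
Unset Printing Implicit Defensive.

Import Order.TTheory GRing.Theory Num.Theory.

Local Open Scope ring_scope.

(* In coordinates every 1-cocycle on r3m1 with values in the exterior square
   has the matrix [cob a b c d], and the only co-Jacobi condition is d c = 0.
   Since ad h is diagonal with eigenvalues 1, -1, 0 and an automorphism
   preserves the plane spanned by x and y, an automorphism either rescales x
   and y or exchanges their lines, according to the sign of the h-component of
   the image of h, which is 1 or -1.  It acts on the parameters by
     (a, b, c, d) |-> (a m - d be, b l + d al, c l m, d)
   in the first case, and by a map of this form followed by
     (a, b, c, d) |-> (- b, - a, c, - d)
   in the second.  The normal forms are representatives of these orbits. *)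

(** * Functoriality of the exterior square and transport of bialgebra structures *)

Section Transport.
Variable K : fieldType.

(** [linfun F] only records the values of [F] on a basis, so linearity of [F] is what makes the two
    agree everywhere. *)
Lemma linear_lfunE (V W : vectType K) (F : V -> W) :
  linear F -> linfun F =1 F.
Proof.
move=> lin v.
pose L := GRing.isLinear.Build _ _ _ _ _ lin.
exact: (lfunE (HB.pack F L : {linear V -> W})).
Qed.

Lemma tensor_map_linear (V W : vectType K) (u w : 'Hom(V, W)) :
  linear (tensor_map u w).
Proof.
move=> a s t; apply/lfunP => f.
by rewrite add_lfunE scale_lfunE !comp_lfunE add_lfunE scale_lfunE linearP.
Qed.

Lemma tensor_mapD (V W : vectType K) (u w : 'Hom(V, W)) s t :
  tensor_map u w (s + t) = tensor_map u w s + tensor_map u w t.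
Proof. by have := tensor_map_linear u w 1 s t; rewrite !scale1r. Qed.

Lemma tensor_mapZ (V W : vectType K) (u w : 'Hom(V, W)) a t :
  tensor_map u w (a *: t) = a *: tensor_map u w t.
Proof.
apply/lfunP => f; rewrite scale_lfunE !comp_lfunE scale_lfunE.
exact: linearZ.
Qed.

Lemma tensor_map_comp (U V W : vectType K) (u u' : 'Hom(U, V))
    (w w' : 'Hom(V, W)) (t : tensor2 U) :
  tensor_map w w' (tensor_map u u' t) = tensor_map (w \o u)%VF (w' \o u')%VF t.
Proof.
apply/lfunP => f; rewrite !comp_lfunE !transposeE.
by rewrite comp_lfunA.
Qed.

Lemma tensor_map_id (V : vectType K) (t : tensor2 V) :
  tensor_map \1%VF \1%VF t = t.
Proof.
by apply/lfunP => f; rewrite !comp_lfunE transposeE id_lfunE comp_lfun1r.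
Qed.

(** Wedges of basis vectors span the source, and [tensor_map_wedge] sends each of them to a
    wedge. *)
Lemma tensor_map_ext2 (V W : vectType K) (u : 'Hom(V, W)) (t : tensor2 V) :
  t \in ext2 V -> tensor_map u u t \in ext2 W.
Proof.
pose X := in_tuple
  [seq wedge p q | p <- vbasis fullv, q <- vbasis (fullv : {vspace V})].
move=> tX; rewrite (coord_span (tX : t \in <<X>>%VS)).
elim/big_ind: _ => [|s r hs hr|i _].
(* Writing 0 as [0 *: t] lets [tensor_mapZ] compute its image. *)
- by rewrite -(scale0r t) tensor_mapZ scale0r mem0v.
- by rewrite tensor_mapD memvD.
rewrite tensor_mapZ memvZ //=.
have /allpairsP[[p q] [_ _ ->]] : X`_i \in X by apply: mem_nth (ltn_ord i).
by rewrite tensor_map_wedge wedge_ext2.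
Qed.

Lemma adj2E (V : vectType K) (br : V -> V -> V) s t (f : dual V) :
  adj2 br s t f = t (f \o linfun (br s))%VF + linfun (br s) (t f).
Proof.
rewrite add_lfunE !comp_lfunE !transposeE !id_lfunE.
by rewrite comp_lfun1r.
Qed.

Lemma adj2D (V : vectType K) (br : V -> V -> V) s t t' :
  adj2 br s (t + t') = adj2 br s t + adj2 br s t'.
Proof. by rewrite /adj2 !tensor_mapD addrACA. Qed.

Lemma adj2Z (V : vectType K) (br : V -> V -> V) s a t :
  adj2 br s (a *: t) = a *: adj2 br s t.
Proof. by rewrite /adj2 !tensor_mapZ scalerDr. Qed.

(** A Lie homomorphism intertwines [ad s] with [ad (phi s)]; this is the fact [comm], applied once
    in each tensor factor. *)
Lemma tensor_map_adj2 (V W : vectType K) (brV : V -> V -> V)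
    (brW : W -> W -> W) (phi : 'Hom(V, W)) s t :
  is_lie_bracket brV -> is_lie_bracket brW ->
  (forall u v, phi (brV u v) = brW (phi u) (phi v)) ->
  tensor_map phi phi (adj2 brV s t) = adj2 brW (phi s) (tensor_map phi phi t).
Proof.
case=> linV _ _ _ [linW _ _ _] hom.
have comm : (phi \o linfun (brV s) = linfun (brW (phi s)) \o phi)%VF.
  by apply/lfunP => v; rewrite !comp_lfunE !linear_lfunE.
apply/lfunP => f.
rewrite adj2E !comp_lfunE adj2E !transposeE linearD /=.
congr (_ + _); first by rewrite -!comp_lfunA comm.
by rewrite -!comp_lfunE comm !comp_lfunE.
Qed.

Lemma dual_bracketE (V : vectType K) (delta : 'Hom(V, tensor2 V)) f g v :
  dual_bracket delta f g v = g (delta v f).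
Proof.
by rewrite /dual_bracket linear_lfunE // => a s t;
  rewrite /pairing linearP add_lfunE scale_lfunE linearP.
Qed.

(** Once this is known for every linear [delta], only alternation and Jacobi remain when a dual
    bracket is shown to be Lie. *)
Lemma dual_bracket_bilinear (V : vectType K) (delta : 'Hom(V, tensor2 V)) :
  (forall f, linear (dual_bracket delta f)) /\
  (forall g, linear ((dual_bracket delta)^~ g)).
Proof.
split=> [f|g] a s t; apply/lfunP => v; rewrite add_lfunE scale_lfunE.
  by rewrite !dual_bracketE add_lfunE scale_lfunE.
by rewrite !dual_bracketE !linearP.
Qed.

(** In general [phi^-1] is only a pseudo-inverse: injectivity makes it a left inverse, and
    surjectivity then a right one. *)
Lemma lie_iso_inv (V W : vectType K) (brV : V -> V -> V) (brW : W -> W -> W)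
    (phi : 'Hom(V, W)) :
  is_lie_iso brV brW phi ->
  [/\ is_lie_iso brW brV (phi^-1)%VF, cancel phi (phi^-1)%VF &
      cancel (phi^-1)%VF phi].
Proof.
case=> -[psi phiK psiK] hom.
have k1 : cancel phi (phi^-1)%VF.
  by apply: lker0_lfunK; apply/lker0P/(can_inj phiK).
have k2 : cancel (phi^-1)%VF phi by move=> w; rewrite -(psiK w) k1.
split=> //; split; first by exists phi.
by move=> u v; apply: (can_inj k1); rewrite hom !k2.
Qed.

Lemma bialgebra_isomorphic_sym (V W : vectType K) (brV : V -> V -> V)
    (dV : 'Hom(V, tensor2 V)) (brW : W -> W -> W) (dW : 'Hom(W, tensor2 W)) :
  bialgebra_isomorphic brV dV brW dW -> bialgebra_isomorphic brW dW brV dV.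
Proof.
case=> phi /lie_iso_inv [iso k1 k2] h; exists (phi^-1)%VF => // w.
rewrite -[in RHS](k2 w) h tensor_map_comp.
have -> : (phi^-1 \o phi = \1)%VF.
  by apply/lfunP => v; rewrite comp_lfunE id_lfunE k1.
by rewrite tensor_map_id.
Qed.

Lemma bialgebra_isomorphic_trans (U V W : vectType K) (brU : U -> U -> U)
    (dU : 'Hom(U, tensor2 U)) (brV : V -> V -> V)
    (dV : 'Hom(V, tensor2 V)) (brW : W -> W -> W) (dW : 'Hom(W, tensor2 W)) :
  bialgebra_isomorphic brU dU brV dV -> bialgebra_isomorphic brV dV brW dW ->
  bialgebra_isomorphic brU dU brW dW.
Proof.
case=> f [bf hf] df [g [bg hg] dg]; exists (g \o f)%VF; last first.
  by move=> u; rewrite comp_lfunE dg df tensor_map_comp.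
split; last by move=> u v; rewrite !comp_lfunE hf hg.
by apply: (eq_bij (bij_comp bg bf)) => u; rewrite comp_lfunE.
Qed.

(** The cobracket on [W] is [delta] conjugated by [phi]. This reduces the classification to
    cobrackets on one fixed copy of the Lie algebra. *)
Lemma bialgebra_transport (V W : vectType K) (brV : V -> V -> V)
    (dV : 'Hom(V, tensor2 V)) (brW : W -> W -> W) :
  is_lie_bracket brW -> is_lie_bialgebra brV dV -> lie_isomorphic brV brW ->
  exists2 dW : 'Hom(W, tensor2 W), is_lie_bialgebra brW dW &
    bialgebra_isomorphic brV dV brW dW.
Proof.
move=> lieW [lieV extV [_ _ altV jacV] cocV] [phi iso].
have [_ hom] := iso; have [[_ ihom] k1 k2] := lie_iso_inv iso.
have lin : linear (fun w => tensor_map phi phi (dV (phi^-1%VF w))).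
  by move=> a u v; rewrite !linearP tensor_map_linear.
pose dW : 'Hom(W, tensor2 W) :=
  linfun (fun w => tensor_map phi phi (dV (phi^-1%VF w))).
have dWE w : dW w = tensor_map phi phi (dV (phi^-1%VF w)).
  exact: linear_lfunE.
have dbE f g : dual_bracket dW f g =
    (dual_bracket dV (f \o phi)%VF (g \o phi)%VF \o phi^-1)%VF.
  apply/lfunP => w.
  by rewrite comp_lfunE !dual_bracketE dWE !comp_lfunE transposeE.
(* Precomposition with [phi] carries the dual bracket of [dW] to that of [dV], so the nested
   brackets of Jacobi can be computed on the side of [V]. *)
have pull f g : (dual_bracket dW f g \o phi)%VF =
    dual_bracket dV (f \o phi)%VF (g \o phi)%VF.
  by apply/lfunP => v; rewrite dbE !comp_lfunE k1.
exists dW; last first.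
  by exists phi => // v; rewrite dWE k1.
have [lin1 lin2] := dual_bracket_bilinear dW.
split=> //.
- by move=> w; rewrite dWE; apply: tensor_map_ext2.
- split=> //.
    by move=> f; rewrite dbE altV comp_lfun0l.
  move=> f g h; rewrite (dbE f) (dbE g (dual_bracket _ _ _)).
  by rewrite (dbE h (dual_bracket _ _ _)) !pull -!comp_lfunDl jacV comp_lfun0l.
move=> s t.
rewrite !dWE ihom cocV tensor_mapD -scaleN1r tensor_mapZ scaleN1r.
by rewrite !(tensor_map_adj2 _ _ lieV lieW hom) !k2.
Qed.

End Transport.

(** * The algebra [r3m1] in coordinates *)

Section R3.
Variable R : realType.
Local Notation V := 'rV[R]_3.
Local Notation i0 := (inord 0 : 'I_3).
Local Notation i1 := (inord 1 : 'I_3).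
Local Notation i2 := (inord 2 : 'I_3).
Local Notation ex := (ex R).
Local Notation ey := (ey R).
Local Notation eh := (eh R).
Local Notation r3m1 := (@r3m1 R).
Local Notation "M ~~> N" :=
  (bialgebra_isomorphic r3m1 (cobracket_of M) r3m1 (cobracket_of N))
  (at level 70).

Lemma ord3P (P : 'I_3 -> Prop) : P i0 -> P i1 -> P i2 -> forall i, P i.
Proof.
move=> P0 P1 P2 i; rewrite -(inord_val i).
by case: i => -[|[|[|?]]].
Qed.

Lemma sum3E (U : nmodType) (F : 'I_3 -> U) :
  \sum_(i < 3) F i = F i0 + F i1 + F i2.
Proof.
rewrite !big_ord_recr big_ord0 /= add0r.
by congr (F _ + F _ + F _); apply/val_inj; rewrite /= inordK.
Qed.

Lemma row3P (u v : V) :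
  u 0 i0 = v 0 i0 -> u 0 i1 = v 0 i1 -> u 0 i2 = v 0 i2 -> u = v.
Proof. by move=> *; apply/rowP; apply: ord3P. Qed.

Lemma inord3_eqE :
  ((i0 == i1) = false) * ((i0 == i2) = false) * ((i1 == i0) = false) *
  ((i1 == i2) = false) * ((i2 == i0) = false) * ((i2 == i1) = false).
Proof. by do !split; rewrite -(inj_eq val_inj) /= !inordK. Qed.

Lemma basisE :
  (ex 0 i0 = 1) * (ex 0 i1 = 0) * (ex 0 i2 = 0) *
  (ey 0 i0 = 0) * (ey 0 i1 = 1) * (ey 0 i2 = 0) *
  (eh 0 i0 = 0) * (eh 0 i1 = 0) * (eh 0 i2 = 1).
Proof. by do !split; rewrite mxE !(eqxx, inord3_eqE). Qed.

Lemma row3_basis (v : V) : v = v 0 i0 *: ex + v 0 i1 *: ey + v 0 i2 *: eh.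
Proof. by apply: row3P; rewrite !mxE !(eqxx, inord3_eqE) /=; ring. Qed.

Lemma r3m1E (u v : V) :
  (r3m1 u v 0 i0 = u 0 i2 * v 0 i0 - u 0 i0 * v 0 i2) *
  (r3m1 u v 0 i1 = u 0 i1 * v 0 i2 - u 0 i2 * v 0 i1) *
  (r3m1 u v 0 i2 = 0).
Proof. by do !split; rewrite !mxE !(eqxx, inord3_eqE) /=; ring. Qed.

Lemma r3m1_lie : is_lie_bracket r3m1.
Proof.
split.
- move=> u a v w; apply: row3P;
    by rewrite !(mxE, r3m1E, inord3_eqE, eqxx) /=; ring.
- move=> u a v w; apply: row3P;
    by rewrite !(mxE, r3m1E, inord3_eqE, eqxx) /=; ring.
- by move=> u; apply: row3P; rewrite r3m1E mxE; ring.
- move=> u v w; apply: row3P;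
    rewrite [LHS]mxE [X in X + _]mxE [RHS]mxE;
    (* The final rewrite serves [r3m1 u v], whose coordinates appear only once the outer bracket
       with [w] is unfolded. *)
    rewrite !(r3m1E u) !(r3m1E v) !(r3m1E w) ?(r3m1E u);
    ring.
Qed.

(** * Dual coordinates and the exterior square of the three-dimensional space *)

Definition coordf (i : 'I_3) : dual V := linfun (fun v : V => v 0 i : R^o).

Lemma coordfE i (v : V) : coordf i v = v 0 i.
Proof. by rewrite linear_lfunE // => a u w; rewrite !mxE. Qed.

(** Retyping the value from [R^o] to [R] places the computations that follow in the ring [R], for
    [ring] and [lra]. *)
Definition pairingR (f g : dual V) (t : tensor2 V) : R := pairing f g t.

Lemma pairingR_tens f g p q : pairingR f g (tens p q) = (f p : R) * (g q : R).
Proof. by rewrite /pairingR /pairing tensE linearZ. Qed.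

Lemma pairingRD f g s t : pairingR f g (s + t) = pairingR f g s + pairingR f g t.
Proof. by rewrite /pairingR /pairing add_lfunE linearD. Qed.

Lemma pairingRZ f g a t : pairingR f g (a *: t) = a * pairingR f g t.
Proof. by rewrite /pairingR /pairing scale_lfunE linearZ. Qed.

Lemma pairingRN f g t : pairingR f g (- t) = - pairingR f g t.
Proof. by rewrite -scaleN1r pairingRZ mulN1r. Qed.

Lemma dualE (f : dual V) v :
  f v = v 0 i0 * (f ex : R) + v 0 i1 * (f ey : R) + v 0 i2 * (f eh : R) :> R.
Proof. by rewrite {1}[v]row3_basis !linearD !linearZ. Qed.

Lemma dualP (f g : dual V) :
  f ex = g ex -> f ey = g ey -> f eh = g eh -> f = g.
Proof. by move=> h0 h1 h2; apply/lfunP => v; rewrite dualE [RHS]dualE h0 h1 h2. Qed.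

(** A tensor is a linear map on the dual, hence determined by its values on the dual basis, and
    these by their coordinates. *)
Lemma tensor2P (s t : tensor2 V) :
  (forall i j,
     pairingR (coordf i) (coordf j) s = pairingR (coordf i) (coordf j) t) ->
  s = t.
Proof.
move=> h; have hi i : s (coordf i) = t (coordf i).
  by apply/rowP => j; have := h i j; rewrite /pairingR /pairing !coordfE.
apply/lfunP => f.
have -> : f = (f ex : R) *: coordf i0 + (f ey : R) *: coordf i1
   + (f eh : R) *: coordf i2.
  by apply: dualP; rewrite !add_lfunE !scale_lfunE !coordfE !basisE;
    rewrite /GRing.scale /= !(mulr0, mulr1, addr0, add0r).
by rewrite !linearD !linearZ /= !hi.
Qed.

Definition ext2_comb (a b c : R) : tensor2 V :=
  a *: wedge ex ey + b *: wedge ey eh + c *: wedge eh ex.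

Lemma ext2_combE a b c :
  a *: wedge ex ey + b *: wedge ey eh + c *: wedge eh ex = ext2_comb a b c.
Proof. by []. Qed.

Lemma pairingR_wedge f g p q : pairingR f g (wedge p q) =
  (f p : R) * (g q : R) - (f q : R) * (g p : R).
Proof. by rewrite /wedge pairingRD pairingRN !pairingR_tens. Qed.

Lemma pairingR_comb f g a b c : pairingR f g (ext2_comb a b c) =
  a * ((f ex : R) * (g ey : R) - (f ey : R) * (g ex : R)) +
  b * ((f ey : R) * (g eh : R) - (f eh : R) * (g ey : R)) +
  c * ((f eh : R) * (g ex : R) - (f ex : R) * (g eh : R)).
Proof. by rewrite /ext2_comb !pairingRD !pairingRZ !pairingR_wedge. Qed.

Lemma ext2_comb_mem a b c : ext2_comb a b c \in ext2 V.
Proof. by rewrite !memvD ?memvZ ?wedge_ext2. Qed.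

Lemma ext2_comb_eq a b c a' b' c' : a = a' -> b = b' -> c = c' ->
  ext2_comb a b c = ext2_comb a' b' c'.
Proof. by move=> -> -> ->. Qed.

(** Pairing with consecutive dual basis vectors, in cyclic order, isolates the three coefficients in
    turn. *)
Lemma ext2_comb_inj a b c a' b' c' :
  ext2_comb a b c = ext2_comb a' b' c' -> [/\ a = a', b = b' & c = c'].
Proof.
move=> e; have h i j := congr1 (pairingR (coordf i) (coordf j)) e.
have := (h i0 i1, h i1 i2, h i2 i0).
by rewrite !pairingR_comb !coordfE !basisE => -[[]]; split; lra.
Qed.

(** The coefficients are the 2 by 2 minors of the pair, in cyclic order. *)
Lemma wedge_comb (p q : V) : wedge p q =
  ext2_comb (p 0 i0 * q 0 i1 - p 0 i1 * q 0 i0)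
            (p 0 i1 * q 0 i2 - p 0 i2 * q 0 i1)
            (p 0 i2 * q 0 i0 - p 0 i0 * q 0 i2).
Proof.
apply: tensor2P => i j; rewrite pairingR_wedge pairingR_comb !coordfE.
by elim/ord3P: i; elim/ord3P: j; rewrite !basisE; ring.
Qed.

Lemma ext2_combD a b c a' b' c' :
  ext2_comb a b c + ext2_comb a' b' c' = ext2_comb (a + a') (b + b') (c + c').
Proof. by apply: tensor2P => i j; rewrite pairingRD !pairingR_comb; ring. Qed.

Lemma ext2_combZ k a b c :
  k *: ext2_comb a b c = ext2_comb (k * a) (k * b) (k * c).
Proof. by apply: tensor2P => i j; rewrite pairingRZ !pairingR_comb; ring. Qed.

Lemma ext2_comb_lin3 x y z a b c a' b' c' a'' b'' c'' :
  x *: ext2_comb a b c + y *: ext2_comb a' b' c' + z *: ext2_comb a'' b'' c''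
  = ext2_comb (x * a + y * a' + z * a'') (x * b + y * b' + z * b'')
              (x * c + y * c' + z * c'').
Proof.
by apply: tensor2P => i j; rewrite 2!pairingRD 3!pairingRZ !pairingR_comb; ring.
Qed.

Lemma ext2_combN a b c : - ext2_comb a b c = ext2_comb (- a) (- b) (- c).
Proof. by apply: tensor2P => i j; rewrite pairingRN !pairingR_comb; ring. Qed.

(* Keeps unification from unfolding these two constants, which is very slow. *)
Opaque ext2_comb pairingR.

(** Both sides are linear in [t], which leaves the spanning wedges; their coefficients are known
    from [wedge_comb]. *)
Lemma ext2E t : t \in ext2 V ->
  t = ext2_comb (pairingR (coordf i0) (coordf i1) t)
                (pairingR (coordf i1) (coordf i2) t)
                (pairingR (coordf i2) (coordf i0) t).
Proof.
pose X := in_tuple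
  [seq wedge p q | p <- vbasis fullv, q <- vbasis (fullv : {vspace V})].
have wE (p q : V) : wedge p q = ext2_comb
    (pairingR (coordf i0) (coordf i1) (wedge p q))
    (pairingR (coordf i1) (coordf i2) (wedge p q))
    (pairingR (coordf i2) (coordf i0) (wedge p q)).
  rewrite {1}wedge_comb !pairingR_wedge !coordfE.
  by apply: ext2_comb_eq; rewrite [X in _ - X]mulrC.
move=> tX; rewrite (coord_span (tX : t \in <<X>>%VS)).
elim/big_ind: _ => [|s u hs hu|i _].
- apply: tensor2P => i j.
  by rewrite -(scale0r t) !pairingRZ !mul0r pairingR_comb; ring.
- by rewrite {1}hs {1}hu ext2_combD !pairingRD.
have /allpairsP[[p q] [_ _ ->]] : X`_i \in X by apply: mem_nth (ltn_ord i).
by rewrite {1}(wE p q) ext2_combZ !pairingRZ.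
Qed.

Lemma lfun3E (U : vectType R) (L : 'Hom(V, U)) v :
  L v = v 0 i0 *: L ex + v 0 i1 *: L ey + v 0 i2 *: L eh.
Proof. by rewrite -!linearZ -!linearD -row3_basis. Qed.

Lemma cobracketE (M : 'M[R]_3) (v : V) :
  cobracket_of M v =
  ext2_comb (M i0 i0 * v 0 i0 + M i0 i1 * v 0 i1 + M i0 i2 * v 0 i2)
            (M i1 i0 * v 0 i0 + M i1 i1 * v 0 i1 + M i1 i2 * v 0 i2)
            (M i2 i0 * v 0 i0 + M i2 i1 * v 0 i1 + M i2 i2 * v 0 i2).
Proof.
have colE j :
    cobracket_of M (delta_mx 0 j) = ext2_comb (M i0 j) (M i1 j) (M i2 j).
  by rewrite cobracket_ofE sum3E /ext2_basis !inordK //= ext2_combE.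
rewrite lfun3E !colE ext2_comb_lin3.
by apply: ext2_comb_eq; ring.
Qed.

Lemma cobracket_ex2 (delta : 'Hom(V, tensor2 V)) :
  (forall v, delta v \in ext2 V) -> exists M, delta = cobracket_of M.
Proof.
move=> h; pose c (j : 'I_3) := delta (delta_mx 0 j).
(* Column [j] lists the coordinates, as given by [ext2E], of the image of the [j]-th basis
   vector. *)
exists (\matrix_(i, j) nth 0 [:: pairingR (coordf i0) (coordf i1) (c j);
                         pairingR (coordf i1) (coordf i2) (c j);
                         pairingR (coordf i2) (coordf i0) (c j)] i).
apply/lfunP => v; rewrite cobracketE !mxE !inordK //= lfun3E.
rewrite (ext2E (h ex)) (ext2E (h ey)) (ext2E (h eh)) -!/(c _).
rewrite ext2_comb_lin3.
by apply: ext2_comb_eq; rewrite mulrC; congr (_ + _ + _); exact: mulrC.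
Qed.

Lemma tensor_map_comb (phi : 'Hom(V, V)) a b c :
  tensor_map phi phi (ext2_comb a b c) =
  a *: wedge (phi ex) (phi ey) + b *: wedge (phi ey) (phi eh)
  + c *: wedge (phi eh) (phi ex).
Proof.
by rewrite -ext2_combE !tensor_mapD !tensor_mapZ !tensor_map_wedge.
Qed.

(** [ad h] has weights 0, -1, 1 on the three basis bivectors, while [ad x] and [ad y] map the
    exterior square into the line of [wedge ex ey]. *)
Lemma adj2_comb (s : V) a b c :
  adj2 r3m1 s (ext2_comb a b c) =
  ext2_comb (s 0 i0 * b - s 0 i1 * c) (- (s 0 i2 * b)) (s 0 i2 * c).
Proof.
rewrite -ext2_combE (adj2D _ _ (_ + _)) (adj2D _ _ (_ *: _)) !adj2Z.
rewrite !adj2_wedge; try exact: r3m1_lie.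
rewrite !wedge_comb !ext2_combD ext2_comb_lin3 !r3m1E !basisE.
by apply: ext2_comb_eq; ring.
Qed.

(** * Cocycles and the co-Jacobi condition in coordinates *)

Definition cob (a b c d : R) : 'M[R]_3 :=
  mx3 [:: [:: a; b; c]; [:: 0; - d; - a]; [:: d; 0; - b]].

Lemma cobE a b c d :
  (cob a b c d i0 i0 = a) * (cob a b c d i0 i1 = b) * (cob a b c d i0 i2 = c) *
  (cob a b c d i1 i0 = 0) * (cob a b c d i1 i1 = - d) *
  (cob a b c d i1 i2 = - a) *
  (cob a b c d i2 i0 = d) * (cob a b c d i2 i1 = 0) *
  (cob a b c d i2 i2 = - b).
Proof. by do !split; rewrite mxE !inordK. Qed.

Lemma cobracket_cobE a b c d (v : V) : cobracket_of (cob a b c d) v =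
  ext2_comb (a * v 0 i0 + b * v 0 i1 + c * v 0 i2)
            (- (d * v 0 i1) - a * v 0 i2) (d * v 0 i0 - b * v 0 i2).
Proof. by rewrite cobracketE !cobE; apply: ext2_comb_eq; ring. Qed.

Lemma cob_cocycle a b c d (s t : V) (delta := cobracket_of (cob a b c d)) :
  delta (r3m1 s t) = - adj2 r3m1 t (delta s) + adj2 r3m1 s (delta t).
Proof.
rewrite /delta !cobracket_cobE !adj2_comb ext2_combN ext2_combD !r3m1E.
by apply: ext2_comb_eq; ring.
Qed.

(** The pairs [(h, x)] and [(h, y)] make two entries equal to their opposites, hence zero, and tie
    the last column to the first row; the pair [(x, y)] relates the two entries that remain. *)
Lemma cocycle_cob (M : 'M[R]_3) (delta := cobracket_of M) :
  (forall s t : V,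
     delta (r3m1 s t) = - adj2 r3m1 t (delta s) + adj2 r3m1 s (delta t)) ->
  M = cob (M i0 i0) (M i0 i1) (M i0 i2) (M i2 i0).
Proof.
move=> coc; have := (coc eh ex, coc eh ey, coc ex ey).
rewrite /delta !cobracketE !adj2_comb !ext2_combN !ext2_combD !r3m1E !basisE.
case=> -[/ext2_comb_inj[? ? ?] /ext2_comb_inj[? ? ?]] /ext2_comb_inj[? ? ?].
by apply/matrixP => i j; elim/ord3P: i; elim/ord3P: j; rewrite !cobE; lra.
Qed.

Lemma dual_bracket_cobE a b c d (f g : dual V)
    (db := dual_bracket (cobracket_of (cob a b c d)))
    (xy := (f ex : R) * (g ey : R) - (f ey : R) * (g ex : R))
    (yh := (f ey : R) * (g eh : R) - (f eh : R) * (g ey : R))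
    (hx := (f eh : R) * (g ex : R) - (f ex : R) * (g eh : R)) :
  [/\ db f g ex = a * xy + d * hx :> R, db f g ey = b * xy - d * yh :> R &
      db f g eh = c * xy - a * yh - b * hx :> R].
Proof.
have E v : db f g v = pairingR f g (cobracket_of (cob a b c d) v).
  exact: dual_bracketE.
by split; rewrite E cobracket_cobE pairingR_comb !basisE /xy /yh /hx; ring.
Qed.

(** On the dual basis the Jacobi sum has value [- 2 d c] at [eh], which gives one direction. For the
    other, the values at [ex] and [ey] vanish identically, and the value at [eh] vanishes as soon as
    [d] or [c] does. *)
Lemma cob_jacobi a b c d (db := dual_bracket (cobracket_of (cob a b c d))) :
  d * c = 0 <->
  forall f g h, db f (db g h) + db g (db h f) + db h (db f g) = 0.
Proof.
have Ex f g := let: And3 e _ _ := dual_bracket_cobE a b c d f g in e.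
have Ey f g := let: And3 _ e _ := dual_bracket_cobE a b c d f g in e.
have Eh f g := let: And3 _ _ e := dual_bracket_cobE a b c d f g in e.
split=> [dc f g h|jac].
  apply: dualP; rewrite !add_lfunE zero_lfunE /db.
  - by rewrite !Ex !Ey !Eh; ring.
  - by rewrite !Ey !Ex !Eh; ring.
  - rewrite !Eh !Ex !Ey.
    by move/eqP: dc; rewrite mulf_eq0 => /orP[]/eqP ->; ring.
have /(congr1 (fun f : dual V => f eh : R)) :=
  jac (coordf i0) (coordf i1) (coordf i2).
rewrite !add_lfunE zero_lfunE /db !Eh !Ex !Ey !coordfE !basisE.
by move=> h; lra.
Qed.

Lemma bialgebra_cobP (M : 'M[R]_3) :
  is_lie_bialgebra r3m1 (cobracket_of M) <->
  exists a b c d, d * c = 0 /\ M = cob a b c d.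
Proof.
split=> [[_ _ [_ _ _ jac] /cocycle_cob E]|[a [b [c [d [dc ->]]]]]].
  exists (M i0 i0), (M i0 i1), (M i0 i2), (M i2 i0); split=> //.
  by move: jac; rewrite E => /cob_jacobi; rewrite !cobE.
have [lin1 lin2] := dual_bracket_bilinear (cobracket_of (cob a b c d)).
split; last exact: cob_cocycle.
- exact: r3m1_lie.
- by move=> v; rewrite cobracket_cobE ext2_comb_mem.
- split=> //; last exact/cob_jacobi.
  move=> f; have [hx hy hh] := dual_bracket_cobE a b c d f f.
  by apply: dualP; rewrite zero_lfunE ?hx ?hy ?hh; ring.
Qed.

(** * Automorphisms and their action on the cocycle parameters *)

Definition diag_aut (l m al be : R) : 'Hom(V, V) :=
  linfun (fun v : V => (l * v 0 i0 + al * v 0 i2) *: ex +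
                       (m * v 0 i1 + be * v 0 i2) *: ey + v 0 i2 *: eh).

Lemma diag_autE l m al be (v : V) :
  (diag_aut l m al be v 0 i0 = l * v 0 i0 + al * v 0 i2) *
  (diag_aut l m al be v 0 i1 = m * v 0 i1 + be * v 0 i2) *
  (diag_aut l m al be v 0 i2 = v 0 i2).
Proof.
have -> : diag_aut l m al be v = (l * v 0 i0 + al * v 0 i2) *: ex +
    (m * v 0 i1 + be * v 0 i2) *: ey + v 0 i2 *: eh.
  rewrite /diag_aut linear_lfunE // => a u w.
  by apply: row3P; rewrite !(mxE, inord3_eqE, eqxx) /=; ring.
by do !split; rewrite !(mxE, inord3_eqE, eqxx) /=; ring.
Qed.

(** Negating [eh] exchanges the eigenvalues 1 and -1 of [ad h], hence the roles of [ex] and [ey]. *)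
Definition flip : 'Hom(V, V) :=
  linfun (fun v : V => v 0 i1 *: ex + v 0 i0 *: ey - v 0 i2 *: eh).

Lemma flipE (v : V) :
  (flip v 0 i0 = v 0 i1) * (flip v 0 i1 = v 0 i0) * (flip v 0 i2 = - v 0 i2).
Proof.
have -> : flip v = v 0 i1 *: ex + v 0 i0 *: ey - v 0 i2 *: eh.
  rewrite /flip linear_lfunE // => a u w.
  by apply: row3P; rewrite !(mxE, inord3_eqE, eqxx) /=; ring.
by do !split; rewrite !(mxE, inord3_eqE, eqxx) /=; ring.
Qed.

Lemma diag_isomorphic a b c d l m al be : l != 0 -> m != 0 ->
  cob a b c d ~~> cob (a * m - d * be) (b * l + d * al) (c * l * m) d.
Proof.
move=> l0 m0; exists (diag_aut l m al be); last first.
  move=> v; rewrite !cobracket_cobE tensor_map_comb !wedge_comb ext2_comb_lin3.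
  by rewrite !diag_autE !basisE; apply: ext2_comb_eq; ring.
split; last by move=> u v; apply: row3P; rewrite !(diag_autE, r3m1E); ring.
exists (diag_aut l^-1 m^-1 (- al / l) (- be / m)) => v;
  by apply: row3P; rewrite !diag_autE; field.
Qed.

Lemma flip_isomorphic a b c d : cob a b c d ~~> cob (- b) (- a) c (- d).
Proof.
exists flip; last first.
  move=> v; rewrite !cobracket_cobE tensor_map_comb !wedge_comb ext2_comb_lin3.
  by rewrite !flipE !basisE; apply: ext2_comb_eq; ring.
split; last by move=> u v; apply: row3P; rewrite !(flipE, r3m1E); ring.
by exists flip => v; apply: row3P; rewrite !flipE; ring.
Qed.

(** The images of [ex] and [ey] are eigenvectors, for 1 and -1, of the adjoint action of the image
    of [eh]; as brackets have no [eh]-component, both lie in the plane of [ex] and [ey]. *)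
Lemma r3m1_isoP (phi : 'Hom(V, V)) : is_lie_iso r3m1 r3m1 phi ->
  exists l m al be, [/\ l != 0, m != 0 &
    [/\ phi ex = l *: ex, phi ey = m *: ey & phi eh = al *: ex + be *: ey + eh]
    \/
    [/\ phi ex = l *: ey, phi ey = m *: ex & phi eh = al *: ex + be *: ey - eh]].
Proof.
case=> /bij_inj inj hom.
have neq0 (v : V) i : v 0 i = 1 -> phi v <> 0.
  move=> vi; rewrite -[X in _ <> X](linear0 phi) => /inj v0.
  by move: vi; rewrite v0 mxE => /esym/eqP; rewrite oner_eq0.
have nX : phi ex <> 0 by apply: (neq0 _ i0); rewrite basisE.
have nY : phi ey <> 0 by apply: (neq0 _ i1); rewrite basisE.
have := hom eh ey; rewrite r3m1_hy linearN /= => hY.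
have := hom eh ex; rewrite r3m1_hx => hX.
move: hX hY nX nY.
set X := phi ex; set Y := phi ey; set H := phi eh => hX hY nX nY.
have [X0 X1 X2] : [/\ X 0 i0 = H 0 i2 * X 0 i0 - H 0 i0 * X 0 i2,
    X 0 i1 = H 0 i1 * X 0 i2 - H 0 i2 * X 0 i1 & X 0 i2 = 0].
  by split; rewrite {1}hX r3m1E.
have hYi i : - Y 0 i = r3m1 H Y 0 i by rewrite -hY mxE.
have [Y0 Y1 Y2] : [/\ - Y 0 i0 = H 0 i2 * Y 0 i0 - H 0 i0 * Y 0 i2,
    - Y 0 i1 = H 0 i1 * Y 0 i2 - H 0 i2 * Y 0 i1 & - Y 0 i2 = 0].
  by split; rewrite hYi r3m1E.
have {}Y2 : Y 0 i2 = 0 by lra.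
rewrite X2 !mulr0 ?subr0 ?sub0r in X0 X1.
rewrite Y2 !mulr0 ?subr0 ?sub0r in Y0 Y1.
(* By now [X0] and [X1] say that [X] has coordinates scaled by [H 0 i2] and by its opposite;
   whichever coordinate is nonzero fixes [H 0 i2] as 1 or -1. *)
have [X00|X00] := eqVneq (X 0 i0) 0.
  have X10 : X 0 i1 != 0.
    by apply/eqP => h; apply: nX; apply: row3P; rewrite ?mxE.
  have H2 : H 0 i2 = -1 by apply: (mulIf X10); lra.
  rewrite H2 in Y0 Y1.
  have Y10 : Y 0 i1 = 0 by lra.
  have Y00 : Y 0 i0 != 0.
    by apply/eqP => h; apply: nY; apply: row3P; rewrite ?mxE.
  exists (X 0 i1), (Y 0 i0), (H 0 i0), (H 0 i1); split=> //; right.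
  by split; apply: row3P; rewrite !(mxE, inord3_eqE, eqxx) /= ?X00 ?X2 ?Y10 ?Y2 ?H2;
    ring.
have H2 : H 0 i2 = 1 by apply: (mulIf X00); lra.
rewrite H2 in X1 Y0 Y1.
have X10 : X 0 i1 = 0 by lra.
have Y00 : Y 0 i0 = 0 by lra.
have Y10 : Y 0 i1 != 0.
  by apply/eqP => h; apply: nY; apply: row3P; rewrite ?mxE.
exists (X 0 i0), (Y 0 i1), (H 0 i0), (H 0 i1); split=> //; left.
by split; apply: row3P; rewrite !(mxE, inord3_eqE, eqxx) /= ?X10 ?X2 ?Y00 ?Y2 ?H2;
  ring.
Qed.

Lemma cob_isomorphicP a b c d a' b' c' d' :
  cob a b c d ~~> cob a' b' c' d' ->
  exists l m al be, [/\ l != 0, m != 0 &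
    [/\ a' = a * m - d * be, b' = b * l + d * al, c' = c * l * m & d' = d] \/
    [/\ a' = - b * l - d * be, b' = - a * m + d * al, c' = c * l * m & d' = - d]].
Proof.
case=> phi /r3m1_isoP[l [m [al [be [l0 m0 h]]]]] comm.
exists l, m, al, be; split=> //.
have := (comm ex, comm ey, comm eh).
rewrite !cobracket_cobE !tensor_map_comb !wedge_comb !ext2_comb_lin3.
case=> -[/ext2_comb_inj[eX0 eX1 eX2] /ext2_comb_inj[eY0 eY1 eY2]].
move=> /ext2_comb_inj[eH0 eH1 eH2].
case: h => -[hX hY hH]; [left|right];
  move: eX0 eX1 eX2 eY0 eY1 eY2 eH0 eH1 eH2;
  rewrite hX hY hH !(mxE, inord3_eqE, eqxx) /=;
  move=> eX0 eX1 eX2 eY0 eY1 eY2 eH0 eH1 eH2.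
(* The equations at [ex] and [ey] carry a spare factor [l] or [m], which is cancelled to get [d'],
   [a'] and [b']; substituting these in the equation at [eh] gives [c']. *)
- have d'E : d' = d by apply: (mulIf l0); lra.
  rewrite d'E in eX0 eX1 eX2 eY0 eY1 eY2 eH0 eH1 eH2.
  have aE : a' = a * m - d * be by apply: (mulIf l0); lra.
  have bE : b' = b * l + d * al by apply: (mulIf m0); lra.
  split=> //; rewrite aE bE in eH0.
  by lra.
- have d'E : d' = - d by apply: (mulIf l0); lra.
  rewrite d'E in eX0 eX1 eX2 eY0 eY1 eY2 eH0 eH1 eH2.
  have aE : a' = - b * l - d * be by apply: (mulIf m0); lra.
  have bE : b' = - a * m + d * al by apply: (mulIf l0); lra.
  split=> //; rewrite aE bE in eH0.
  by lra.
Qed.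

(** * Representatives of the orbits: existence and uniqueness *)

Lemma normal_formP (M : 'M[R]_3) : normal_form M <->
  exists a b c d, M = cob a b c d /\
    ([/\ a = 0, b = 0, c = 0 & 0 < d] \/
     d = 0 /\ ([/\ a = 0, b = 0 & c = 0 \/ c = 1] \/
               [/\ a = 1, b = 0 & c = 0 \/ c = 1] \/ a = 1 /\ b = 1)).
Proof.
have cob00 a b c : cob a b c 0 =
    mx3 [:: [:: a; b; c]; [:: 0; 0; - a]; [:: 0; 0; - b]].
  by rewrite /cob oppr0.
split.
  case=> [a3 a3_gt0|||||c1].
  - by exists 0, 0, 0, a3; rewrite /cob oppr0; split=> //; left.
  - exists 0, 0, 0, 0; split; last by right; split=> //; left; split=> //; left.
    by apply/matrixP => i j; elim/ord3P: i; elim/ord3P: j; rewrite !cobE mxE ?oppr0.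
  - by exists 0, 0, 1, 0; rewrite cob00 oppr0; split=> //; right; split=> //;
      left; split=> //; right.
  - by exists 1, 0, 0, 0; rewrite cob00 oppr0; split=> //; right; split=> //;
      right; left; split=> //; left.
  - by exists 1, 0, 1, 0; rewrite cob00 oppr0; split=> //; right; split=> //;
      right; left; split=> //; right.
  - by exists 1, 1, c1, 0; rewrite cob00; split=> //; right; split=> //;
      right; right.
case=> a [b [c [d [-> [[-> -> -> d0]|[-> h]]]]]].
  by rewrite /cob oppr0; apply: NF_a3.
rewrite cob00; case: h => [[-> -> [->|->]]|[[-> -> [->|->]]|[-> ->]]]; rewrite ?oppr0.
- suff -> : mx3 [:: [:: 0; 0; 0]; [:: 0; 0; 0]; [:: 0; 0; 0]] = 0 :> 'M[R]_3.
    exact: NF_zero.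
  by apply/matrixP => i j; elim/ord3P: i; elim/ord3P: j; rewrite !mxE !inordK.
- exact: NF_c.
- exact: NF_a.
- exact: NF_ac.
- exact: NF_abc.
Qed.

(** If [d] is nonzero, then [c = 0] and shifting [eh] removes [a] and [b]. If [d = 0], the shifts
    act trivially and the parameters are normalised by rescaling and by the flip. *)
Lemma normal_form_ex a b c d : d * c = 0 ->
  exists2 M, normal_form M & cob a b c d ~~> M.
Proof.
move=> dc.
have [d0|d0] := eqVneq d 0; last first.
  have c0 : c = 0 by apply: (mulfI d0); rewrite dc mulr0.
  have iso : cob a b c d ~~> cob 0 0 0 d.
    (* [al] and [be] solve [b + d al = 0] and [a - d be = 0], with [l = m = 1]. *)
    have := diag_isomorphic a b c d (- b / d) (a / d) (oner_neq0 R) (oner_neq0 R).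
    have -> : a * 1 - d * (a / d) = 0 by field.
    have -> : b * 1 + d * (- b / d) = 0 by field.
    by rewrite c0 !mul0r.
  case/orP: (lt_total d0) => [d_lt0|d_gt0]; last first.
    by exists (cob 0 0 0 d) => //; apply/normal_formP; exists 0, 0, 0, d; split=> //; left.
  exists (cob 0 0 0 (- d)).
    apply/normal_formP; exists 0, 0, 0, (- d); split=> //; left.
    by rewrite oppr_gt0.
  apply: bialgebra_isomorphic_trans iso _.
  by have := flip_isomorphic 0 0 0 d; rewrite oppr0.
subst d => {dc}.
have scale (x y z l m : R) : l != 0 -> m != 0 ->
    cob x y z 0 ~~> cob (x * m) (y * l) (z * l * m) 0.
  move=> l0 m0; have := diag_isomorphic x y z 0 0 0 l0 m0.
  by rewrite !mul0r subr0 addr0.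
have nf (x y z : R) : ([/\ x = 0, y = 0 & z = 0 \/ z = 1] \/
    [/\ x = 1, y = 0 & z = 0 \/ z = 1] \/ x = 1 /\ y = 1) ->
    normal_form (cob x y z 0).
  by move=> h; apply/normal_formP; exists x, y, z, 0; split=> //; right.
have axis x z : exists2 M, normal_form M & cob x 0 z 0 ~~> M.
  (* [m] turns a nonzero [x] into 1; [l] is still free because the second parameter is 0, and makes
     [z l m] equal to 1 when [z] is nonzero. The value 1 is taken where there is nothing to
     normalise. *)
  pose l := if z == 0 then 1 else if x == 0 then z^-1 else x / z.
  pose m := if x == 0 then 1 else x^-1.
  have l0 : l != 0.
    rewrite /l; case: ifPn => z0; first exact: oner_neq0.
    by case: ifPn => x0; rewrite ?mulf_neq0 ?invr_eq0.
  have m0 : m != 0.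
    by rewrite /m; case: ifPn => x0; rewrite ?oner_neq0 ?invr_eq0.
  exists (cob (x * m) (0 * l) (z * l * m) 0); last exact: scale.
  apply: nf; rewrite mul0r /l /m.
  have [->|x0] := eqVneq x 0; have [->|z0] := eqVneq z 0.
  - by left; split; rewrite ?mul0r //; left.
  - by left; split; rewrite ?mul0r //; right; field.
  - by right; left; split; rewrite ?mulfV //; left; rewrite !mul0r.
  - by right; left; split; rewrite ?mulfV //; right; field; rewrite x0.
have [->|b0] := eqVneq b 0; first exact: axis.
have [->|a0] := eqVneq a 0.
  (* The flip moves the nonzero parameter [b] to the first place. *)
  have [M nfM iso] := axis (- b) c; exists M => //.
  apply: bialgebra_isomorphic_trans iso.
  by have := flip_isomorphic 0 b c 0; rewrite oppr0.
(* Making both [a] and [b] equal to 1 uses up [l] and [m]; what becomes of [c] is the free parameter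
   of the last family. *)
exists (cob (a * a^-1) (b * b^-1) (c * b^-1 * a^-1) 0).
  by apply: nf; right; right; rewrite !mulfV.
by apply: scale; rewrite invr_eq0.
Qed.

(** Orbits are separated by [d] up to sign; when [d = 0], by how many of [a] and [b] vanish; and
    then by [c] up to the factor [l m]. *)
Lemma normal_form_uniq (M N : 'M[R]_3) :
  normal_form M -> normal_form N -> M ~~> N -> M = N.
Proof.
move=> /normal_formP[a [b [c [d [-> nf]]]]] /normal_formP[a' [b' [c' [d' [-> nf']]]]].
move=> /cob_isomorphicP[l [m [al [be [l0 m0 h]]]]].
have lm0 : l * m != 0 by rewrite mulf_neq0.
(* A nonzero factor [l m] preserves the vanishing of [c], which tells 0 from 1. *)
have eqC : c = 0 \/ c = 1 -> c' = 0 \/ c' = 1 -> c' = c * l * m -> c = c'.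
  move=> [->|->] [->|->] //; rewrite ?mul0r ?mul1r // => E.
    by rewrite -E eqxx in lm0.
suff [-> -> -> ->] : [/\ a = a', b = b', c = c' & d = d'] by [].
case: nf => [[? ? ? d_gt0]|[d0 nf]]; case: nf' => [[? ? ? d'_gt0]|[d'0 nf']]; subst.
- by case: h => -[_ _ _ ?]; split=> //; lra.
- by case: h => -[_ _ _ ?]; lra.
- by case: h => -[_ _ _ ?]; lra.
have {}h : [/\ a' = a * m, b' = b * l & c' = c * l * m] \/
    [/\ a' = - b * l, b' = - a * m & c' = c * l * m].
  by case: h => -[-> -> -> _]; [left|right]; split=> //; ring.
move: l0 m0 => /eqP l0 /eqP m0.
case: nf => [[? ? hc]|[[? ? hc]|[? ?]]];
  case: nf' => [[? ? hc']|[[? ? hc']|[? ?]]]; subst;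
  case: h => -[ha hb E]; try lra; try by case: m0; lra.
(* Five cases survive. In the first three [b = b' = 0] and [c], [c'] are 0 or 1. In the last two all
   of [a], [b], [a'], [b'] are 1, which forces [l = m = 1] or [l = m = -1]; either way [l m = 1] and
   [c] is unchanged. *)
- by split=> //; apply: eqC.
- by split=> //; apply: eqC.
- by split=> //; apply: eqC.
- have [lE mE] : l = 1 /\ m = 1 by split; lra.
  by split=> //; rewrite E lE mE !mulr1.
have [lE mE] : l = -1 /\ m = -1 by split; lra.
by split=> //; rewrite E lE mE; ring.
Qed.

End R3.

Theorem mainTheorem4 (R : realType) :
  (forall M : 'M[R]_3, normal_form M ->
     is_lie_bialgebra (@r3m1 R) (cobracket_of M)) /\
  (forall (V : vectType R) (br : V -> V -> V) (delta : 'Hom(V, tensor2 V)),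
     is_lie_bialgebra br delta ->
     lie_isomorphic br (@r3m1 R) ->
     exists! M : 'M[R]_3,
       normal_form M /\
       bialgebra_isomorphic br delta (@r3m1 R) (cobracket_of M)).
Proof.
split=> [M /normal_formP[a [b [c [d [-> nf]]]]]|V br delta bialg iso].
  apply/bialgebra_cobP; exists a, b, c, d; split=> //.
  (* Every normal form has [c = 0] or [d = 0]. *)
  by case: nf => [[_ _ -> _]|[-> _]]; rewrite ?mulr0 ?mul0r.
(* From here on the cobracket lives on [r3m1] itself and is given by a matrix. *)
have [delta0 bialg0 iso0] := bialgebra_transport (r3m1_lie R) bialg iso.
have [_ ext0 _ _] := bialg0.
have [M0 delta0E] := cobracket_ex2 ext0.
move: bialg0; rewrite delta0E => /bialgebra_cobP[a [b [c [d [dc M0E]]]]].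
have [M nfM isoM] := normal_form_ex a b dc.
have isoVM : bialgebra_isomorphic br delta (@r3m1 R) (cobracket_of M).
  by apply: bialgebra_isomorphic_trans iso0 _; rewrite delta0E M0E.
(* Two representatives of the same bialgebra are isomorphic to each other through it. *)
exists M; split=> // N [nfN isoVN]; apply: normal_form_uniq => //.
exact: bialgebra_isomorphic_trans (bialgebra_isomorphic_sym isoVM) isoVN.
Qed.
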